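(* For every integer $m\ge 1$, the following identity holds in $\mathbb{Z}[a_0,\ldots,a_m]$: $$H_{1,1,2}(m) = -2a_0^2\, D(m,1) - 2 (a_0+a_1)\,D(m,0).$$
   Context: Let $m\ge 1$ and let $a_0,\ldots,a_m$ be independent commuting variables over $\mathbb{Z}$; put $a_l:=0$ for every integer $l\notin\{0,\ldots,m\}$. Let $t,U$ be further commuting variables. The determinant of a $0\times 0$ matrix is $1$. Let $\mathcal M_2$ be the $(m+1)\times(m+1)$ matrix over $\mathbb{Z}[a_0,\ldots,a_m][t]$ with $(i,j)$-th entry $a_{2j-i}\,t^2-2a_{2j-i-1}\,t+a_{2j-i-2}$ ($1\le i,j\le m+1$). The polynomials $H_{i,j,2}(m)\in\mathbb{Z}[a_0,\ldots,a_m]$ are defined by $$\det(\mathcal M_2-U I_{m+1})=\sum_{i=0}^{m+1}\sum_{j=0}^{2(m+1-i)}H_{i,j,2}(m)\,t^j(-U)^{i}.$$ Let $\mathcal M_0$ be the $(m-1)\times(m-1)$ matrix over $\mathbb{Z}[a_0,\ldots,a_m]$ with $(i,j)$-th entry $a_{2j-i}$ ($1\le i,j\le m-1$). The polynomials $D(m,i)\in\mathbb{Z}[a_0,\ldots,a_m]$ are defined for $i\in\{0,\ldots,m-1\}$ by $$\det(\mathcal M_0-U I_{m-1})=\sum_{i=0}^{m-1}D(m,i)\,(-U)^{i},$$ and $D(m,i):=0$ for $i\notin\{0,\ldots,m-1\}$. *)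

(* Defs.v *)
From mathcomp Require Import all_boot all_order all_fingroup all_algebra.
From mathcomp Require Import zify.
From mathcomp Require Import mpoly.

Set Implicit Arguments.
Unset Strict Implicit.
Unset Printing Implicit Defensive.

Import GRing.Theory.
Local Open Scope ring_scope.

Notation coefRing m := {mpoly int[m.+1]}.

Definition avar (m : nat) (l : int) : coefRing m :=
  match l with
  | Posz k => if insub k is Some i then 'X_(i : 'I_m.+1) else 0
  | Negz _ => 0
  end.

(* The variable 'X of the polynomial ring is t.  Ordinals start at 0, so the
   1-based row and column indices are i.+1 and j.+1. *)
Definition M2 (m : nat) : 'M[{poly coefRing m}]_m.+1 :=
  \matrix_(i, j)
    let r := i.+1%:Z in let c := j.+1%:Z in
    ((avar m (2 * c - r))%:P * 'X^2
     - (2 * avar m (2 * c - r - 1))%:P * 'X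
     + (avar m (2 * c - r - 2))%:P).

Definition M0 (m : nat) : 'M[coefRing m]_m.-1 :=
  \matrix_(i, j)
    let r := i.+1%:Z in let c := j.+1%:Z in avar m (2 * c - r).

(* det (A - U I), the outermost 'X being U. *)
Definition detU (R : comNzRingType) (n : nat) (A : 'M[R]_n) : {poly R} :=
  \det (map_mx polyC A - 'X%:M).

(* H2 m i j is the coefficient of t^j (-U)^i. *)
Definition H2 (m i j : nat) : coefRing m := (-1) ^+ i * ((detU (M2 m))`_i)`_j.

(* Defined for all i; it vanishes for i >= m by [D_out]. *)
Definition D (m i : nat) : coefRing m := (-1) ^+ i * (detU (M0 m))`_i.

Definition bounded (R : nzRingType) (k : nat) (p : {poly {poly R}}) :=
  forall i j, (2 * k < 2 * i + j)%N -> (p`_i)`_j = 0.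

Lemma bounded1 (R : nzRingType) : bounded 0 (1 : {poly {poly R}}).
Proof.
move=> i j h; rewrite coef1; case: i h => [|i] h /=; last by rewrite coef0.
by rewrite coef1; case: j h.
Qed.

Lemma boundedM (R : nzRingType) k l (p q : {poly {poly R}}) :
  bounded k p -> bounded l q -> bounded (k + l) (p * q).
Proof.
move=> hp hq i j h; rewrite coefM coef_sum big1 // => a _.
rewrite coefM big1 // => b _.
case: (ltnP (2 * k) (2 * a + b)) => hab; first by rewrite hp // mul0r.
by rewrite hq ?mulr0 //; have := ltn_ord a; have := ltn_ord b; lia.
Qed.

Lemma bounded_entry (m : nat) (i j : 'I_m.+1) :
  bounded 1 ((map_mx polyC (M2 m) - 'X%:M) i j).
Proof.
move=> a b h; rewrite !mxE coefB coefC coefMn coefX.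
have hX : (((a == 1%N)%:R : {poly coefRing m}) *+ (i == j))`_b = 0.
  rewrite coefMn; case: eqP => [ea|_]; last by rewrite coef0 mul0rn.
  by rewrite coef1 (_ : b == 0%N = false) ?mul0rn //; lia.
rewrite coefB hX subr0; case: eqP => [ea|_]; last by rewrite coef0.
rewrite !(coefD, coefN, coefCM) coefXn coefX coefC.
have [-> -> ->] : [/\ (b == 2%N) = false, (b == 1%N) = false & (b == 0%N) = false].
  by split; lia.
by rewrite !mulr0 subr0 addr0.
Qed.

Lemma bounded_det (m : nat) : bounded m.+1 (detU (M2 m)).
Proof.
move=> a b h; rewrite /detU /determinant coef_sum coef_sum big1 // => s _.
have hP : bounded m.+1 (\prod_i (map_mx polyC (M2 m) - 'X%:M) i (s i)).
  suff : bounded (\sum_(i : 'I_m.+1) 1)%N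
           (\prod_i (map_mx polyC (M2 m) - 'X%:M) i (s i)).
    by rewrite sum1_card card_ord.
  elim/big_rec2: _ => [|i k p _ IH]; first exact: bounded1.
  by apply: boundedM IH; apply: bounded_entry.
rewrite -signr_odd; case: odd; rewrite ?expr1 ?expr0 ?mulN1r ?mul1r ?coefN ?hP ?oppr0 //.
Qed.

Lemma size_detU (R : comNzRingType) n (A : 'M[R]_n) : (size (detU A) <= n.+1)%N.
Proof.
have -> : detU A = (-1) ^+ n * char_poly A.
  by rewrite /char_poly -detZ scaleN1r opprB.
by rewrite -signr_odd; case: odd;
  rewrite ?expr1 ?expr0 ?mulN1r ?mul1r ?size_polyN size_char_poly.
Qed.

Lemma D_out (m i : nat) : (1 <= m)%N -> (m <= i)%N -> D m i = 0.
Proof.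
move=> hm hi; rewrite /D nth_default ?mulr0 //.
by apply: leq_trans (size_detU _) _; rewrite prednK.
Qed.

Lemma detU_expansion (R : comNzRingType) n (A : 'M[R]_n) :
  detU A = \sum_(i < n.+1) ((-1) ^+ i * (detU A)`_i)%:P * (- 'X) ^+ i.
Proof.
have {1}-> : detU A = \poly_(i < n.+1) (detU A)`_i.
  apply/polyP => k; rewrite coef_poly; case: ltnP => // h.
  by rewrite nth_default // (leq_trans (size_detU A)).
rewrite poly_def; apply: eq_bigr => i _.
rewrite (exprNn 'X) -mul_polyC polyCM polyC_exp polyCN polyC1 mulrACA.
by rewrite -expr2 sqrr_sign mul1r.
Qed.

Lemma D_expansion (m : nat) : (1 <= m)%N ->
  detU (M0 m) = \sum_(i < m) (D m i)%:P * (- 'X) ^+ i.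
Proof. by move=> hm; rewrite [LHS]detU_expansion prednK. Qed.

Lemma H2_expansion (m : nat) :
  detU (M2 m) =
  \sum_(i < m.+2) \sum_(j < (2 * (m.+1 - i)).+1)
    ((H2 m i j)%:P * 'X^j)%:P * (- 'X) ^+ i.
Proof.
rewrite [LHS]detU_expansion; apply: eq_bigr => i _.
rewrite -mulr_suml -rmorph_sum; congr (_%:P * _); apply/polyP => k.
transitivity (H2 m i k).
  rewrite /H2 -!(signr_odd _ i); case: odd;
  by rewrite ?expr1 ?expr0 ?mulN1r ?mul1r ?coefN.
rewrite coef_sum; case: (ltnP k (2 * (m.+1 - i)).+1) => hk.
  rewrite (bigD1 (Ordinal hk)) //= coefCM coefXn eqxx mulr1 big1 ?addr0 // => j.
  rewrite -val_eqE /= => hj; rewrite coefCM coefXn eq_sym (negPf hj) mulr0 //.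
rewrite /H2 bounded_det ?mulr0; last by have := ltn_ord i; lia.
rewrite big1 // => j _; rewrite coefCM coefXn.
by rewrite (_ : k == j = false) ?mulr0 //; have := ltn_ord j; lia.
Qed.

(* Main.v *)
Require Import Defs.
From mathcomp Require Import all_boot all_order all_algebra.
From mathcomp Require Import mpoly.
From mathcomp Require Import zify ring.

(** The [t]-linear coefficient of a determinant is the derivative of [\det] at
    the constant part in the direction of the [t]-linear part, namely the sum
    over [i] of the determinants in which only row [i] is differentiated.  The
    constant and the [t]-linear part of [M2] are Hurwitz matrices whose first
    columns vanish below the diagonal, so the Leibniz rule splits off the
    factors [- U] and [- 2 a_0].  What remains to differentiate is the matrix
    [(a_(2j-i-1))], in the direction [(- 2 a_(2j-i))].  There each row of the
    direction but the first is proportional to the previous row of the matrix,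
    so a single determinant survives, namely [- 2 a_1 \det M0]. *)

Set Implicit Arguments.
Unset Strict Implicit.
Unset Printing Implicit Defensive.

Import GRing.Theory.
Local Open Scope ring_scope.

Definition minor0 (R : Type) n (A : 'M[R]_n.+1) : 'M[R]_n :=
  row' ord0 (col' ord0 A).

Definition col0_cleared (R : nmodType) n (A : 'M[R]_n.+1) : Prop :=
  forall i, A (lift ord0 i) ord0 = 0.

Definition replace_row (R : Type) n (i : 'I_n) (A B : 'M[R]_n) : 'M[R]_n :=
  \matrix_(k, j) (if k == i then B else A) k j.

Definition det_deriv (R : comPzRingType) n (A B : 'M[R]_n) : R :=
  \sum_i \det (replace_row i A B).

Section DetDeriv.
Variable R : comPzRingType.

Lemma det_col0_cleared n (A : 'M[R]_n.+1) :
  col0_cleared A -> \det A = A ord0 ord0 * \det (minor0 A).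
Proof.
move=> A0; rewrite (expand_det_col _ ord0) big_ord_recl big1 => [|i _].
  by rewrite addr0 /cofactor expr0 mul1r.
by rewrite A0 mul0r.
Qed.

Lemma det_row_proportional n (A : 'M[R]_n) i1 i2 c :
  i1 != i2 -> (forall j, A i1 j = c * A i2 j) -> \det A = 0.
Proof.
move=> i1'i2 A12; pose B := replace_row i1 A (\matrix_(_, j) A i2 j).
have detB : \det B = 0.
  apply: (determinant_alternate i1'i2) => j.
  by rewrite !mxE eqxx eq_sym (negPf i1'i2) mxE.
rewrite (@determinant_multilinear _ _ A B A i1 c 0) //.
- by rewrite detB mulr0 mul0r addr0.
- by apply/rowP => j; rewrite !mxE eqxx mxE A12 mul0r addr0.
- by apply/matrixP => k j; rewrite !mxE eq_sym (negPf (neq_lift _ _)).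
Qed.

Lemma minor0_replace_row0 n (A B : 'M[R]_n.+1) :
  minor0 (replace_row ord0 A B) = minor0 A.
Proof. by apply/matrixP => k j; rewrite !mxE. Qed.

Lemma minor0_replace_row_lift n i (A B : 'M[R]_n.+1) :
  minor0 (replace_row (lift ord0 i) A B) = replace_row i (minor0 A) (minor0 B).
Proof.
apply/matrixP => k j.
by rewrite !mxE (inj_eq lift_inj); case: eqP; rewrite !mxE.
Qed.

Lemma replace_row_col0_cleared n i (A B : 'M[R]_n.+1) :
  col0_cleared A -> col0_cleared B -> col0_cleared (replace_row i A B).
Proof. by move=> A0 B0 k; rewrite !mxE; case: eqP. Qed.

Lemma det_deriv_col0_cleared n (A B : 'M[R]_n.+1) :
  col0_cleared A -> col0_cleared B ->
  det_deriv A B = B ord0 ord0 * \det (minor0 A)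
                  + A ord0 ord0 * det_deriv (minor0 A) (minor0 B).
Proof.
move=> A0 B0; rewrite /det_deriv big_ord_recl; congr (_ + _).
  rewrite det_col0_cleared; last exact: replace_row_col0_cleared.
  by rewrite minor0_replace_row0 mxE eqxx.
rewrite mulr_sumr; apply: eq_bigr => i _.
rewrite det_col0_cleared; last exact: replace_row_col0_cleared.
by rewrite minor0_replace_row_lift mxE.
Qed.

Lemma det_deriv_row_shift n c (A B : 'M[R]_n.+1) :
  (forall i j, B (lift ord0 i) j = c * A (widen_ord (leqnSn n) i) j) ->
  det_deriv A B = \det (replace_row ord0 A B).
Proof.
move=> BA; rewrite /det_deriv big_ord_recl big1 ?addr0 // => i _.
have widen'lift : lift ord0 i != widen_ord (leqnSn n) i.
  by rewrite -val_eqE /= /bump; lia.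
apply: (@det_row_proportional _ _ _ _ c widen'lift) => j.
by rewrite !mxE eqxx eq_sym (negPf widen'lift) BA.
Qed.

End DetDeriv.

Lemma det_deriv_map_mx (R S : comPzRingType) (f : {rmorphism R -> S}) n
    (A B : 'M[R]_n) :
  det_deriv (map_mx f A) (map_mx f B) = f (det_deriv A B).
Proof.
rewrite rmorph_sum; apply: eq_bigr => i _; rewrite -det_map_mx.
by congr (\det _); apply/matrixP => k j; rewrite !mxE; case: eqP; rewrite mxE.
Qed.

Section PolyMatrix.
Variable R : comNzRingType.

Lemma coef1_prod n (p : 'I_n -> {poly R}) :
  (\prod_i p i)`_1 = \sum_i \prod_k (p k)`_(k == i).
Proof.
elim: n p => [|n IHn] p; first by rewrite !big_ord0 coef1.
rewrite !big_ord_recl coefM big_ord_recr big_ord1 /= subnn IHn addrC.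
congr (_ + _); first by rewrite /= coef0_prod.
rewrite mulr_sumr; apply: eq_bigr => i _; rewrite big_ord_recl /=.
by congr (_ * _); apply: eq_bigr => k _; rewrite (inj_eq lift_inj).
Qed.

Lemma coef0_det n (A : 'M[{poly R}]_n) :
  (\det A)`_0 = \det (map_mx (coefp 0) A).
Proof. by rewrite det_map_mx. Qed.

Lemma coef1_det n (A : 'M[{poly R}]_n) :
  (\det A)`_1 = det_deriv (map_mx (coefp 0) A) (map_mx (coefp 1) A).
Proof.
rewrite /det_deriv exchange_big coef_sum; apply: eq_bigr => s _ /=.
rewrite -mulr_sumr -(rmorph_sign polyC) coefCM coef1_prod; congr (_ * _).
apply: eq_bigr => i _; apply: eq_bigr => k _.
by rewrite mxE; case: eqP; rewrite mxE.
Qed.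

End PolyMatrix.

(** The opposite of [char_poly_mx], so that [detU A] is [\det (pencil A)]. *)
Definition pencil (R : nzRingType) n (A : 'M[R]_n) : 'M[{poly R}]_n :=
  map_mx polyC A - 'X%:M.

Section Pencil.
Variable R : comNzRingType.

Lemma coefp0_pencil n (A : 'M[R]_n) : map_mx (coefp 0) (pencil A) = A.
Proof.
apply/matrixP => i j; rewrite !mxE /= coefB coefC coefMn coefX mul0rn.
exact: subr0.
Qed.

Lemma coefp0_map_polyC n (A : 'M[R]_n) : map_mx (coefp 0) (map_mx polyC A) = A.
Proof. by apply/matrixP => i j; rewrite !mxE polyCK. Qed.

Lemma minor0_pencil n (A : 'M[R]_n.+1) : minor0 (pencil A) = pencil (minor0 A).
Proof. by apply/matrixP => i j; rewrite !mxE (inj_eq lift_inj). Qed.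

Lemma pencil_col0_cleared n (A : 'M[R]_n.+1) :
  col0_cleared A -> col0_cleared (pencil A).
Proof. by move=> A0 i; rewrite !mxE A0 subr0. Qed.

Lemma coef1_detU n (A : 'M[{poly R}]_n) i :
  (detU A)`_i`_1 =
  (det_deriv (pencil (map_mx (coefp 0) A))
             (map_mx polyC (map_mx (coefp 1) A)))`_i.
Proof.
pose B : 'M[{poly {poly R}}]_n := map_mx swapXY (pencil A).
have B0 : map_mx (coefp 0) B = pencil (map_mx (coefp 0) A).
  apply/matrixP => k j; rewrite !mxE rmorphB rmorphMn /= swapXY_polyC swapXY_X.
  by rewrite coefB coefMn coef_map coefC.
have B1 : map_mx (coefp 1) B = map_mx polyC (map_mx (coefp 1) A).
  apply/matrixP => k j; rewrite !mxE rmorphB rmorphMn /= swapXY_polyC swapXY_X.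
  by rewrite coefB coefMn coef_map coefC mul0rn subr0.
by rewrite -B0 -B1 -coef1_det det_map_mx coef_swapXY.
Qed.

End Pencil.

Definition hurwitz_mx (R : Type) (a : int -> R) n : 'M[R]_n :=
  \matrix_(i, j) a (2 * j.+1%:Z - i.+1%:Z).

Definition causal (R : nmodType) (a : int -> R) : Prop :=
  forall l, l < 0 -> a l = 0.

Definition delay (R : Type) (a : int -> R) (l : int) : R := a (l - 1).

Lemma map_hurwitz_mx (S T : Type) (f : S -> T) a b n :
  f \o a =1 b -> map_mx f (hurwitz_mx a n) = hurwitz_mx b n.
Proof. by move=> fa; apply/matrixP => i j; rewrite !mxE; apply: fa. Qed.

Lemma causal_delay (V : nmodType) (a : int -> V) : causal a -> causal (delay a).
Proof. by move=> a_causal l l0; apply: a_causal; lia. Qed.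

Lemma minor0_hurwitz_delay (T : Type) (a : int -> T) n :
  minor0 (hurwitz_mx (delay a) n.+1) = hurwitz_mx a n.
Proof.
apply/matrixP => i j.
by rewrite !mxE /delay; congr (a _); rewrite /= /bump; lia.
Qed.

Lemma hurwitz_delay_col0_cleared (V : nmodType) (a : int -> V) n :
  causal a -> col0_cleared (hurwitz_mx (delay a) n.+1).
Proof.
by move=> a_causal i; rewrite mxE; apply: a_causal; rewrite /= /bump; lia.
Qed.

(** The coefficients of [(t - x)^2 * \sum_l a_l x^l] in [x], where [t] is ['X];
    [delay] is the multiplication by [x]. *)
Definition tsubx_sqr_mul (R : nzRingType) (a : int -> R) (l : int) : {poly R} :=
  (a l)%:P * 'X^2 - (2 * a (l - 1))%:P * 'X + (a (l - 2))%:P.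

Section Hurwitz.
Variable R : comNzRingType.
Implicit Types a c : int -> R.

Lemma detU_hurwitz_delay a n :
  causal a ->
  detU (hurwitz_mx (delay a) n.+1) = ((a 0)%:P - 'X) * detU (hurwitz_mx a n).
Proof.
move=> a_causal; rewrite /detU det_col0_cleared; last first.
  exact/pencil_col0_cleared/hurwitz_delay_col0_cleared.
by rewrite minor0_pencil minor0_hurwitz_delay !mxE.
Qed.

Lemma det_deriv_pencil_hurwitz_delay a c n :
  causal a -> causal c ->
  det_deriv (pencil (hurwitz_mx (delay a) n.+1))
            (map_mx polyC (hurwitz_mx (delay c) n.+1)) =
  (c 0)%:P * detU (hurwitz_mx a n)
  + ((a 0)%:P - 'X) * det_deriv (pencil (hurwitz_mx a n))
                                (map_mx polyC (hurwitz_mx c n)).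
Proof.
move=> a_causal c_causal; rewrite (@map_hurwitz_mx _ _ _ c (polyC \o c)) //.
rewrite (@map_hurwitz_mx _ _ _ (delay c) (delay (polyC \o c))) //.
rewrite det_deriv_col0_cleared.
- by rewrite minor0_pencil !minor0_hurwitz_delay !mxE.
- exact/pencil_col0_cleared/hurwitz_delay_col0_cleared.
- by apply: hurwitz_delay_col0_cleared => l l0 /=; rewrite c_causal.
Qed.

Lemma det_deriv_hurwitz_delay a k n :
  causal a ->
  det_deriv (hurwitz_mx (delay a) n.+1) (hurwitz_mx (fun l => k * a l) n.+1) =
  k * a 1 * \det (hurwitz_mx a n).
Proof.
move=> a_causal; rewrite (@det_deriv_row_shift _ _ k) => [|i j]; last first.
  by rewrite !mxE; congr (k * a _); rewrite /= /bump; lia.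
rewrite det_col0_cleared => [|i]; last first.
  by rewrite mxE; apply: hurwitz_delay_col0_cleared.
by rewrite minor0_replace_row0 minor0_hurwitz_delay !mxE.
Qed.

Lemma coef0_tsubx_sqr_mul a :
  coefp 0 \o tsubx_sqr_mul a =1 delay (delay a).
Proof.
move=> l; rewrite /tsubx_sqr_mul /= coefD coefB coefC !coefCM coefXn coefX /=.
by rewrite !mulr0 subr0 add0r /delay; congr (a _); lia.
Qed.

Lemma coef1_tsubx_sqr_mul a :
  coefp 1 \o tsubx_sqr_mul a =1 delay (fun l => - 2 * a l).
Proof.
move=> l; rewrite /tsubx_sqr_mul /= coefD coefB coefC !coefCM coefXn coefX /=.
by rewrite mulr0 mulr1 sub0r addr0 /delay mulNr.
Qed.

Lemma coef11_detU_hurwitz a n : causal a ->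
  (detU (hurwitz_mx (tsubx_sqr_mul a) n.+2))`_1`_1 =
  - 2 * a 0 ^+ 2 * (detU (hurwitz_mx a n))`_1
  + 2 * (a 0 + a 1) * (detU (hurwitz_mx a n))`_0.
Proof.
move=> a_causal; have delay_a_causal := causal_delay a_causal.
set p := detU (hurwitz_mx a n).
have c_causal : causal (fun l => - 2 * a l).
  by move=> l /a_causal ->; rewrite mulr0.
have p0 : p`_0 = \det (hurwitz_mx a n) by rewrite coef0_det coefp0_pencil.
rewrite coef1_detU (map_hurwitz_mx _ (coef0_tsubx_sqr_mul a)).
rewrite (map_hurwitz_mx _ (coef1_tsubx_sqr_mul a)).
rewrite det_deriv_pencil_hurwitz_delay // detU_hurwitz_delay // -/p.
set q := det_deriv _ _.
have q0 : q`_0 = - 2 * a 1 * p`_0.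
  rewrite -[q`_0]/(coefp 0 q) -det_deriv_map_mx coefp0_pencil coefp0_map_polyC.
  by rewrite det_deriv_hurwitz_delay // p0.
rewrite [delay a 0]a_causal // polyC0 sub0r [- 'X * q]mulNr mulrBl.
by rewrite coefD coefN coefCM coefB coefCM !coefXM /= q0; ring.
Qed.

End Hurwitz.

Theorem theorem3p1 (m : nat) (hm : (1 <= m)%N) :
  H2 m 1 1 =
    - 2 * avar m 0 ^+ 2 * D m 1 - 2 * (avar m 0 + avar m 1) * D m 0.
Proof.
case: m hm => // n _; have a_causal : causal (avar n.+1) by case.
rewrite /H2 /D -[M2 _]/(hurwitz_mx (tsubx_sqr_mul (avar n.+1)) n.+2).
rewrite coef11_detU_hurwitz // -[M0 _]/(hurwitz_mx (avar n.+1) n).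
ring.
Qed.
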